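(* Let $m$ be a positive integer and $q=2^m$. Then $$f(x)=x^4+x^{q^2+4}+x^{4q+1}+x^{4q^2+1}+x^{q+4}$$ is a permutation polynomial over $\mathbb{F}_{q^3}$ if and only if $m$ is odd.
   Context: $\mathbb{F}_{q^3}$ denotes the finite field with $q^3$ elements. A polynomial $f\in\mathbb{F}_{q^3}[x]$ is a permutation polynomial over $\mathbb{F}_{q^3}$ if the associated map $c\mapsto f(c)$ from $\mathbb{F}_{q^3}$ to itself is a bijection. *)

(* Defs.v *)
From HB Require Import structures.
From mathcomp Require Import all_boot all_order all_algebra.

Set Implicit Arguments.
Unset Strict Implicit.
Unset Printing Implicit Defensive.

Import GRing.Theory.
Local Open Scope ring_scope.

Definition permutation_poly (F : finFieldType) (f : {poly F}) : Prop :=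
  bijective (fun c : F => f.[c]).

(* Main.v *)
(** Write [s = x + x^q + x^(q^2)] for the trace of [x] down to the field with
    [q] elements. In characteristic 2 the polynomial acts as
    [x |-> (1 + s) x^4 + s^4 x], and the trace of this value is [s^4]. So two
    points with the same image have the same trace, and their difference [x]
    satisfies [(1 + s) x^4 = s^4 x] and has trace 0. If [x != 0], then [x^3]
    lies in the subfield, whence [x^q = w x] with [w^3 = 1].
    For odd [m], cubing is injective, so [w = 1] and the trace of [x] is
    [3 x = x], a contradiction. For even [m], some [x] has [x^q = w x] with
    [w != 1]; it has trace 0, and for [t = x^3], [s = t / (1 + t)] the
    distinct points [s] and [s + s x] collide. *)
Require Import Defs.
From HB Require Import structures.
From mathcomp Require Import all_boot all_order all_algebra all_field.
From mathcomp Require Import ring zify.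

Set Implicit Arguments.
Unset Strict Implicit.
Unset Printing Implicit Defensive.

Import GRing.Theory.
Local Open Scope ring_scope.

(** Since 2 is -1 modulo 3, the parity of [m] decides whether 3 divides [q - 1], hence whether
    nontrivial cube roots of unity exist. *)
Lemma pow2_mod3 (m : nat) : (2 ^ m %% 3 = if odd m then 2 else 1)%N.
Proof.
elim: m => // m IHm; rewrite expnS -modnMmr IHm /=.
by case: (odd m).
Qed.

Section CubicExtension.

Variables (m q : nat) (F : finFieldType).
Hypotheses (qE : q = (2 ^ m)%N) (cardF : #|F| = (q ^ 3)%N).

Let q_gt0 : (0 < q)%N. Proof. by rewrite qE expn_gt0. Qed.

Lemma pchar2 : 2%N \in [pchar F].
Proof. by apply: (@card_finPcharP _ 2 (m * 3)) => //; rewrite cardF qE expnM. Qed.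

Lemma exprqD (x y : F) : (x + y) ^+ q = x ^+ q + y ^+ q.
Proof.
apply: exprDn_pchar; rewrite (eq_pnat _ (pcharf_eq pchar2)) qE.
by rewrite pnatX pnat_id.
Qed.

Lemma exprq3 (x : F) : ((x ^+ q) ^+ q) ^+ q = x.
Proof. by rewrite -!exprM -[RHS]expf_card cardF !expnS expn0 muln1 mulnA. Qed.

Let addxx (x : F) : x + x = 0. Proof. exact: (addrr_pchar2 pchar2). Qed.
Let oppx (x : F) : - x = x. Proof. exact: (oppr_pchar2 pchar2). Qed.

Definition tr (x : F) : F := x + x ^+ q + (x ^+ q) ^+ q.

Lemma trD (x y : F) : tr (x + y) = tr x + tr y.
Proof. by rewrite /tr !exprqD; ring. Qed.

Lemma tr_fixed (x : F) : (tr x) ^+ q = tr x.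
Proof. by rewrite /tr !exprqD exprq3; ring. Qed.

Lemma trZ (a x : F) : a ^+ q = a -> tr (a * x) = a * tr x.
Proof. by move=> aq; rewrite /tr !exprMn !aq; ring. Qed.

Lemma tr_subfield (a : F) : a ^+ q = a -> tr a = a.
Proof. by move=> aq; rewrite /tr !aq addxx add0r. Qed.

Lemma exprD4 (x y : F) : (x + y) ^+ 4 = x ^+ 4 + y ^+ 4.
Proof.
by apply: exprDn_pchar; rewrite (eq_pnat _ (pcharf_eq pchar2)).
Qed.

Lemma tr_expr4 (x : F) : tr (x ^+ 4) = (tr x) ^+ 4.
Proof. by rewrite /tr !exprD4 (exprAC x 4) (exprAC _ 4). Qed.

Definition trform (x : F) : F := (1 + tr x) * x ^+ 4 + tr x ^+ 4 * x.

Lemma horner_trform (c : F) :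
  ('X^4 + 'X^(q ^ 2 + 4) + 'X^(4 * q + 1) + 'X^(4 * q ^ 2 + 1) + 'X^(q + 4)
    : {poly F}).[c] = trform c.
Proof.
rewrite !hornerD !hornerXn /trform !exprD expr1 -mulnn exprM.
have -> : tr c ^+ 4 = c ^+ 4 + (c ^+ q) ^+ 4 + ((c ^+ q) ^+ q) ^+ 4.
  by rewrite /tr !exprD4.
rewrite /tr; move: (c ^+ q) ((c ^+ q) ^+ q) => y z.
(* Expanding [trform c] yields [c ^+ 5] twice; this vanishing sum is added on the left so that
   [ring] can conclude. *)
by rewrite -[LHS]addr0 -(addxx (c ^+ 5)); ring.
Qed.

(** With [s = tr x], both [1 + s] and [s ^+ 4] are fixed by the [q]-th power, so they leave the
    trace as scalars: [(1 + s) s^4 + s^4 s = s^4]. *)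
Lemma tr_trform (x : F) : tr (trform x) = tr x ^+ 4.
Proof.
have sq := tr_fixed x.
rewrite /trform trD trZ 1?trZ ?tr_expr4; first by rewrite -[RHS]addr0 -(addxx (tr x ^+ 5)); ring.
  by rewrite exprAC sq.
by rewrite exprqD expr1n sq.
Qed.

Lemma trform_inj : odd m -> injective trform.
Proof.
move=> m_odd c d eqf.
have eqs : tr c = tr d.
  have : tr c ^+ 4 = tr d ^+ 4 by rewrite -!tr_trform eqf.
  move/eqP; rewrite -subr_eq0 oppx -exprD4 expf_eq0 /= -[tr d]oppx subr_eq0.
  by rewrite oppx => /eqP.
apply/eqP; rewrite -subr_eq0 oppx; apply/negPn/negP => x0.
set x := c + d in x0; set s := tr c.
have trx : tr x = 0 by rewrite trD eqs addxx.
have sq : s ^+ q = s := tr_fixed c.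
have kerx : (1 + s) * x ^+ 4 + s ^+ 4 * x = 0.
  move: eqf; rewrite /trform -eqs -/s => /eqP; rewrite -subr_eq0 oppx => /eqP <-.
  by rewrite /x exprD4; ring.
have x3 : (1 + s) * x ^+ 3 = s ^+ 4.
  apply: (mulIf x0); apply/eqP; rewrite -subr_eq0 oppx -[X in _ == X]kerx.
  by apply/eqP; ring.
have s1 : 1 + s != 0.
  apply/eqP => s1; move: x3; rewrite s1 mul0r => /esym/eqP.
  by rewrite expf_eq0 /= => /eqP s0; move: s1; rewrite s0 addr0 => /eqP; rewrite oner_eq0.
(* Raise [x3] to the power [q], which fixes [s], and cancel [1 + s]. *)
have y3 : (x ^+ q) ^+ 3 = x ^+ 3.
  apply: (mulfI s1); rewrite x3.
  have := congr1 (fun u => u ^+ q) x3.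
  by rewrite /= exprMn exprqD expr1n sq (exprAC x) (exprAC s) sq.
(* The exponent inverts cubing: if [q^3 = 3 n + 2], then [3 (2 n + 1) + 1 = 2 q^3], and
   [u^(2 q^3) = u^2]. *)
have cubeK (u : F) : u ^+ 3 ^+ (2 * (q ^ 3 %/ 3) + 1) = u.
  have q3 : (q ^ 3 = (q ^ 3 %/ 3) * 3 + 2)%N.
    rewrite {1}(divn_eq (q ^ 3) 3); congr (_ + _)%N.
    by rewrite -modnXm qE pow2_mod3 m_odd.
  have [->|u0] := eqVneq u 0; first by rewrite -exprM expr0n; case: eqP => //; lia.
  apply: (mulIf u0); rewrite -exprM -exprSr.
  have -> : (3 * (2 * (q ^ 3 %/ 3) + 1)).+1 = (q ^ 3 * 2)%N by lia.
  by rewrite -cardF exprM expf_card expr2.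
have yx : x ^+ q = x by rewrite -[LHS]cubeK y3 cubeK.
by move: trx; rewrite tr_subfield // => x00; rewrite x00 eqxx in x0.
Qed.

(** Otherwise ['X^k - 1] would have more than [k] roots. *)
Lemma ex_expr_neq1 (k : nat) :
  (0 < k < #|F|.-1)%N -> exists2 w : F, w != 0 & w ^+ k != 1.
Proof.
case/andP=> k_gt0 ltk.
suff /existsP[w /andP[w0 wk]] : [exists w : F, (w != 0) && (w ^+ k != 1)].
  by exists w.
apply: contraT; rewrite negb_exists => /forallP allw.
have p0 : 'X^k - 1 != 0 :> {poly F} by rewrite -size_poly_eq0 size_XnsubC.
have := max_poly_roots (rs := enum [pred w : F | w != 0]) p0.
rewrite size_XnsubC // enum_uniq -cardE => /(_ _ isT).
have -> : #|[pred w : F | w != 0]| = #|F|.-1.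
  by rewrite -(cardC1 (0 : F)); apply: eq_card => w; rewrite !inE.
rewrite ltnS leqNgt ltk; apply.
apply/allP => w; rewrite mem_enum inE => w0.
rewrite /root !hornerE subr_eq0.
by have := allw w; rewrite w0 /= negbK.
Qed.

Lemma trform_not_inj : (0 < m)%N -> ~~ odd m -> ~ injective trform.
Proof.
move=> m_gt0 m_even inj.
have q_mod3 : (q %% 3 = 1)%N by rewrite qE pow2_mod3 (negbTE m_even).
pose k := (q %/ 3)%N; have qk : q = (k * 3).+1 by rewrite {1}(divn_eq q 3) q_mod3 addn1.
have k_gt0 : (0 < k)%N.
  have : (1 < q)%N by rewrite qE -{1}(expn0 2) ltn_exp2l.
  by rewrite qk; lia.
(* [e = (q^2 + q + 1) / 3] *)
pose e := (3 * k ^ 2 + 3 * k + 1)%N.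
have q3E : (#|F|.-1 = e * (k * 3) * 3)%N.
  by rewrite cardF qk /e; nia.
(* Here [k * 3 = q - 1], so the exponent is [(q^3 - 1) / 3] and [w] is not a cube; this makes [r]
   below a primitive cube root of unity. *)
have [|w w0 wn] := @ex_expr_neq1 (e * (k * 3))%N.
  by rewrite q3E /e; nia.
pose x := w ^+ e; pose r := x ^+ (k * 3).
have x0 : x != 0 by rewrite expf_neq0.
have r1 : r != 1 by rewrite /r /x -exprM.
have r3 : r ^+ 3 = 1.
  by rewrite /r /x -!exprM mulnA -q3E; apply: (mulIf w0);
     rewrite -exprSr prednK ?expf_card ?mul1r // cardF expn_gt0 q_gt0.
have rr : 1 + r + r ^+ 2 = 0.
  have r10 : r - 1 != 0 by rewrite subr_eq0.
  by apply: (mulfI r10); rewrite mulr0 -(subrr (1 : F)) -{3}r3; ring.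
have xq : x ^+ q = r * x by rewrite qk exprSr.
have rq : r ^+ q = r by rewrite qk exprSr mulnC exprM r3 expr1n mul1r.
have trx : tr x = 0.
  by rewrite /tr xq exprMn rq xq -[RHS](mul0r x) -rr; ring.
pose t := x ^+ 3.
have tq : t ^+ q = t by rewrite /t exprAC xq exprMn r3 mul1r.
have t0 : t != 0 by rewrite expf_neq0.
(* If [t = 1], then [r = t^k = 1]. *)
have t1 : 1 + t != 0.
  rewrite -[t]oppx subr_eq0; apply: contra r1 => /eqP t1.
  by rewrite /r mulnC exprM -/t -t1 expr1n.
(* Since [x^4 = t x], the images of [s] and [s + s x] differ by [s^4 x ((1 + s) t + s)]; this [s]
   solves [(1 + s) t = s]. *)
pose s := t / (1 + t).
have sq : s ^+ q = s by rewrite /s exprMn exprVn exprqD expr1n tq.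
have s0 : s != 0 by rewrite mulf_neq0 ?invr_eq0.
have sx0 : s * x != 0 by rewrite mulf_neq0.
have trs : tr (s + s * x) = s by rewrite trD trZ // trx mulr0 addr0 tr_subfield.
have st : (1 + s) * t = s.
  have sK : s * (1 + t) = t by rewrite /s divfK.
  by rewrite mulrDl mul1r -{1}sK mulrDr mulr1 -addrA addxx addr0.
have : s + s * x = s.
  apply: inj; rewrite /trform trs tr_subfield // exprD4 [(s * x) ^+ 4]exprMn.
  have -> : x ^+ 4 = t * x by rewrite /t -exprSr.
  rewrite [LHS](_ : _ = (1 + s) * s ^+ 4 + s ^+ 4 * s
     + ((1 + s) * t * s ^+ 4 * x + s ^+ 5 * x)); last by ring.
  by rewrite st -exprS addxx addr0.
by move/eqP; rewrite -subr_eq0 addrAC subrr add0r (negbTE sx0).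
Qed.

End CubicExtension.

Theorem theorem3p9 (m q : nat) (F : finFieldType) :
  (0 < m)%N -> q = (2 ^ m)%N -> #|F| = (q ^ 3)%N ->
  permutation_poly
    ('X^4 + 'X^(q ^ 2 + 4) + 'X^(4 * q + 1) + 'X^(4 * q ^ 2 + 1) + 'X^(q + 4)
      : {poly F})
  <-> odd m.
Proof.
move=> m_gt0 qE cardF; have fE := horner_trform qE cardF.
split=> [/bij_inj inj | m_odd].
  apply/negPn/negP => /(trform_not_inj qE cardF m_gt0); apply=> c d.
  by rewrite -!fE => /inj.
by apply: injF_bij => c d; rewrite /= !fE => /(trform_inj qE cardF m_odd).
Qed.
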